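(* Let $R$ be a commutative ring with identity, let $1\le s\le l$ be integers, and let $A\in M_{s\times l}(R)$ be such that $AA^t=\mathrm{adiag}(\lambda_1,\dots,\lambda_s)$ for some $\lambda_1,\dots,\lambda_s\in R$. Suppose that $C_1,\dots,C_s$ are linear codes over $R$ of the same length such that, for each $i=1,\dots,s$, $C_i\subseteq C_{s-i+1}^\perp$ whenever $\lambda_i\neq 0$. Then the matrix-product code $[C_1\,\dots\,C_s]\,A$ is self-orthogonal.
   Context: $M_{s\times l}(R)$ is the set of $s\times l$ matrices over $R$; $A^t$ is the transpose of $A$; $\mathrm{adiag}(\lambda_1,\dots,\lambda_s)$ is the $s\times s$ anti-diagonal matrix whose entry in position $(i,s-i+1)$ is $\lambda_i$ (all other entries $0$). A linear code of length $m$ over $R$ is an $R$-submodule of $R^m$. With $\langle x,y\rangle=\sum_{k} x_ky_k$, the dual of a linear code $C\subseteq R^m$ is $C^\perp=\{x\in R^m : \langle x,c\rangle=0 \text{ for all } c\in C\}$; $C$ is self-orthogonal if $C\subseteq C^\perp$. For linear codes $C_1,\dots,C_s$ of length $m$ and $A=(a_{i,j})\in M_{s\times l}(R)$, the matrix-product code is $[C_1\,\dots\,C_s]\,A=\{(c_1\,\dots\,c_s)A : c_i\in C_i\}$, where $(c_1\,\dots\,c_s)$ is the $m\times s$ matrix whose $i$th column is $c_i$. It is viewed as a linear code of length $ml$ by identifying an $m\times l$ matrix with the concatenation of its columns, so its codewords are $\left(\sum_{i=1}^s a_{i,1}c_i,\dots,\sum_{i=1}^s a_{i,l}c_i\right)$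 with $c_i\in C_i$. *)

(* Defs.v *)
From mathcomp Require Import all_boot all_order all_algebra.
From mathcomp Require Import boolp classical_sets.

Set Implicit Arguments.
Unset Strict Implicit.
Unset Printing Implicit Defensive.

Import GRing.Theory.
Local Open Scope ring_scope.
Local Open Scope classical_set_scope.

(* [comPzRingType] does not require 1 != 0, so the zero ring is allowed.
   Codes are Prop-valued, as membership in a submodule need not be decidable. *)
Definition linear_code (R : comPzRingType) (m : nat) (C : set 'rV[R]_m) : Prop :=
  C 0 /\ forall (a : R) (u v : 'rV[R]_m), C u -> C v -> C (a *: u + v).

Definition inner_product (R : comPzRingType) (m : nat) (x y : 'rV[R]_m) : R :=
  \sum_(k < m) x 0 k * y 0 k.

Definition dual_code (R : comPzRingType) (m : nat) (C : set 'rV[R]_m) :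
    set 'rV[R]_m :=
  [set x | forall c, C c -> inner_product x c = 0].

Definition self_orthogonal (R : comPzRingType) (m : nat) (C : set 'rV[R]_m) :
    Prop :=
  C `<=` dual_code C.

(* Indices start at 0, so [rev_ord i], of value s - i.+1, is the index
   s - i + 1 of the usual numbering from 1. *)
Definition adiag (R : comPzRingType) (s : nat) (lam : 'I_s -> R) : 'M[R]_s :=
  \matrix_(i < s, j < s) (if j == rev_ord i then lam i else 0).

Definition col_matrix (R : comPzRingType) (m s : nat) (c : 'I_s -> 'rV[R]_m) :
    'M[R]_(m, s) :=
  \matrix_(k < m, i < s) c i 0 k.

(* [mxvec] concatenates rows, hence the transpose: the columns of an m x l
   matrix are concatenated into a word of length l * m. *)
Definition matrix_product_code (R : comPzRingType) (m s l : nat)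
    (C : 'I_s -> set 'rV[R]_m) (A : 'M[R]_(s, l)) : set 'rV[R]_(l * m) :=
  [set mxvec (col_matrix c *m A)^T | c in [set c | forall i, C i (c i)]].

Lemma matrix_product_code_linear (R : comPzRingType) (m s l : nat)
    (C : 'I_s -> set 'rV[R]_m) (A : 'M[R]_(s, l)) :
  (forall i, linear_code (C i)) -> linear_code (matrix_product_code C A).
Proof.
move=> linC; split.
  exists (fun=> 0); first by move=> i; case: (linC i).
  suff -> : col_matrix (fun=> 0) = 0 :> 'M[R]_(m, s).
    by rewrite mul0mx trmx0 linear0.
  by apply/matrixP=> k i; rewrite !mxE.
move=> a _ _ [c Cc <-] [d Cd <-].
exists (fun i => a *: c i + d i).
  by move=> i; case: (linC i) => _; apply; [apply: Cc | apply: Cd].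
have -> : col_matrix (fun i => a *: c i + d i) =
    a *: col_matrix c + col_matrix d.
  by apply/matrixP=> k i; rewrite !mxE.
by rewrite mulmxDl -scalemxAl !linearD !linearZ.
Qed.

Lemma matrix_product_codewordE (R : comPzRingType) (m s l : nat)
    (c : 'I_s -> 'rV[R]_m) (A : 'M[R]_(s, l)) (j : 'I_l) (k : 'I_m) :
  mxvec (col_matrix c *m A)^T 0 (mxvec_index j k) =
  (\sum_(i < s) A i j *: c i) 0 k.
Proof.
rewrite mxvecE !mxE summxE; apply: eq_bigr => i _.
by rewrite !mxE mulrC.
Qed.

(* Main.v *)
(* The inner product of two codewords is the trace of D_c A (D_d A)^t, where D_c
   and D_d are the matrices with columns c_i and d_i. By cyclicity of the trace
   this is the trace of (A A^t) (D_d^t D_c), in which D_d^t D_c is a matrix of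
   inner products; as A A^t is anti-diagonal, only the sum of the terms
   lambda_i <c_i, d_{s-i+1}> survives, and each of them vanishes. *)

Require Import Defs.
From mathcomp Require Import all_boot all_order all_algebra.
From mathcomp Require Import boolp classical_sets.

Set Implicit Arguments.
Unset Strict Implicit.
Unset Printing Implicit Defensive.

Import GRing.Theory.
Local Open Scope ring_scope.
Local Open Scope classical_set_scope.

(** Flattening is a bijection on positions, so the sum over the word is a double sum over entries;
    taking the column index outermost gives the trace. *)
Lemma inner_product_mxvec (R : comPzRingType) (n p : nat) (X Y : 'M[R]_(n, p)) :
  inner_product (mxvec X) (mxvec Y) = \tr (X^T *m Y).
Proof.
rewrite /inner_product (reindex _ (curry_mxvec_bij _ _)) /=.
rewrite (eq_bigr (fun ij => X ij.1 ij.2 * Y ij.1 ij.2)); last first.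
  by case=> i j _; rewrite !mxvecE.
rewrite -(pair_bigA _ (fun i j => X i j * Y i j)) exchange_big /=.
by apply: eq_bigr => j _; rewrite mxE; apply: eq_bigr => i _; rewrite mxE.
Qed.

Lemma mul_col_matrixTE (R : comPzRingType) (m s : nat) (c d : 'I_s -> 'rV[R]_m)
    (i j : 'I_s) :
  ((col_matrix d)^T *m col_matrix c) j i = inner_product (c i) (d j).
Proof. by rewrite mxE; apply: eq_bigr => k _; rewrite !mxE mulrC. Qed.

(** Row [i] of [adiag lam] can be nonzero only in column [rev_ord i]. *)
Lemma mxtrace_adiag_mul (R : comPzRingType) (s : nat) (lam : 'I_s -> R)
    (B : 'M[R]_s) :
  \tr (adiag lam *m B) = \sum_(i < s) lam i * B (rev_ord i) i.
Proof.
apply: eq_bigr => i _; rewrite mxE (bigD1 (rev_ord i)) //= big1 => [|j /negPf ji].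
  by rewrite mxE eqxx addr0.
by rewrite mxE ji mul0r.
Qed.

Theorem theorem3p2 (R : comPzRingType) (s l : nat) (hs : (1 <= s)%N)
  (hsl : (s <= l)%N) (A : 'M[R]_(s, l)) (lam : 'I_s -> R)
  (hA : A *m A^T = adiag lam) (m : nat) (C : 'I_s -> set 'rV[R]_m)
  (hC : forall i, linear_code (C i))
  (hdual : forall i, lam i != 0 -> C i `<=` dual_code (C (rev_ord i))) :
  self_orthogonal (matrix_product_code C A).
Proof.
move=> _ [c Cc <-] _ [d Cd <-].
rewrite inner_product_mxvec trmxK trmx_mul !mulmxA -(mulmxA _ A) hA.
rewrite -mulmxA mxtrace_mulC -mulmxA mxtrace_adiag_mul big1 // => i _.
rewrite mul_col_matrixTE.
(* Orthogonality of [C i] and [C (rev_ord i)] is given only for nonzero [lam i]; otherwise the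
   coefficient kills the term. *)
have [-> | lam_neq0] := eqVneq (lam i) 0; first by rewrite mul0r.
by rewrite (hdual i lam_neq0 _ (Cc i) _ (Cd _)) mulr0.
Qed.
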